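(* Let $\mathcal{K}$ be the class of all finite groups of nilpotency class at most $2$ and of exponent dividing $4$ in which every involution is central, and let $\mathcal{G}$ be the Fraïssé limit of $\mathcal{K}$. Then $\mathcal{G}$ (as a structure in the language of groups) has no AZ-enumeration.
   Context: The class $\mathcal{K}$ is closed under subgroups and has the joint embedding and amalgamation properties (known, Cherlin–Saracino–Wood). Its Fraïssé limit is the (unique up to isomorphism) countable locally finite group $\mathcal{G}$ such that the finite groups embeddable into $\mathcal{G}$ are exactly those in $\mathcal{K}$ and every isomorphism between finite subgroups of $\mathcal{G}$ extends to an automorphism of $\mathcal{G}$. An AZ-enumeration of a countable first-order structure $M$ is a linear ordering $<$ of $M$ of order type $\omega$ such that for each $n$ and any sequence $\bar a_i$, $i\in\omega$, of $n$-tuples from $M$ there are $i\neq j$ in $\omega$ and an elementary map (elementary embedding) $\alpha:M\to M$ which is order preserving ($x<y$ implies $\alpha(x)<\alpha(y)$) and satisfies $\alpha(\bar a_i)=\bar a_j$. *)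

(* Defs.v *)
From mathcomp Require Import all_boot all_fingroup all_solvable.
From mathcomp Require Import boolp classical_sets functions cardinality.

Set Implicit Arguments.
Unset Strict Implicit.
Unset Printing Implicit Defensive.

Import GroupScope.

Record language := Language {
  fun_symbol : Type;
  fun_arity : fun_symbol -> nat;
  rel_symbol : Type;
  rel_arity : rel_symbol -> nat }.

Record structure (L : language) := Structure {
  carrier :> Type;
  fun_interp : forall f : fun_symbol L,
    ('I_(fun_arity f) -> carrier) -> carrier;
  rel_interp : forall r : rel_symbol L,
    ('I_(rel_arity r) -> carrier) -> Prop }.

Inductive term (L : language) : Type :=
| Var of nat
| App (f : fun_symbol L) of ('I_(fun_arity f) -> term L).

Inductive formula (L : language) : Type :=
| Eq of term L & term L
| Rel (r : rel_symbol L) of ('I_(rel_arity r) -> term L)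
| Bot
| Neg of formula L
| And of formula L & formula L
| Or of formula L & formula L
| Imp of formula L & formula L
| All of nat & formula L
| Ex of nat & formula L.

Fixpoint eval (L : language) (M : structure L) (v : nat -> M) (t : term L)
    : M :=
  match t with
  | Var n => v n
  | App f ts => fun_interp (fun k => eval v (ts k))
  end.

Definition update (T : Type) (v : nat -> T) (n : nat) (x : T) : nat -> T :=
  fun k => if k == n then x else v k.

Fixpoint satisfies (L : language) (M : structure L) (v : nat -> M)
    (phi : formula L) : Prop :=
  match phi with
  | Eq s t => eval v s = eval v t
  | Rel r ts => rel_interp (fun k => eval v (ts k))
  | Bot => False
  | Neg p => ~ satisfies v p
  | And p q => satisfies v p /\ satisfies v q
  | Or p q => satisfies v p \/ satisfies v q
  | Imp p q => satisfies v p -> satisfies v q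
  | All n p => forall x : M, satisfies (update v n x) p
  | Ex n p => exists x : M, satisfies (update v n x) p
  end.

Definition elementary (L : language) (M N : structure L) (alpha : M -> N)
    : Prop :=
  forall (phi : formula L) (v : nat -> M),
    satisfies v phi <-> satisfies (alpha \o v) phi.

(* The isomorphism with (nat, <) forces lt to be a strict linear order. *)
Definition order_type_omega (T : Type) (lt : T -> T -> Prop) : Prop :=
  exists2 e : nat -> T, bijective e &
    forall i j : nat, lt (e i) (e j) <-> (i < j)%N.

Definition AZ_enumeration (L : language) (M : structure L)
    (lt : M -> M -> Prop) : Prop :=
  order_type_omega lt /\
  forall (n : nat) (a : nat -> n.-tuple M),
    exists i j : nat, i <> j /\
      exists alpha : M -> M,
        [/\ elementary alpha,
            forall x y : M, lt x y -> lt (alpha x) (alpha y)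
          & map_tuple alpha (a i) = a j].

Inductive group_symbol := MulSymbol | InvSymbol | OneSymbol.

Definition group_arity (f : group_symbol) : nat :=
  match f with MulSymbol => 2 | InvSymbol => 1 | OneSymbol => 0 end.

Definition group_language : language :=
  @Language group_symbol group_arity void (fun _ => 0).

Definition group_fun_interp (G : groupType) (f : group_symbol)
    : ('I_(group_arity f) -> G) -> G :=
  match f return ('I_(group_arity f) -> G) -> G with
  | MulSymbol => fun x => x ord0 * x ord_max
  | InvSymbol => fun x => (x ord0)^-1
  | OneSymbol => fun _ => 1
  end.

Definition group_structure (G : groupType) : structure group_language :=
  @Structure group_language G (@group_fun_interp G)
    (fun r : void => match r with end).

Definition subgroup (G : groupType) (H : set G) : Prop :=
  H 1 /\ forall x y : G, H x -> H y -> H (x * y^-1).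

Definition locally_finite (G : groupType) : Prop :=
  forall S : set G, finite_set S -> finite_set (smallest (@subgroup G) S).

Definition embeds (gT : finGroupType) (G : groupType) : Prop :=
  exists f : {multiplicative gT -> G}, injective f.

(* The isomorphism from A to B is given by a function on all of G, of which
   only the restriction to A matters. *)
Definition ultrahomogeneous (G : groupType) : Prop :=
  forall (A B : set G) (f : G -> G),
    subgroup A -> finite_set A -> subgroup B -> finite_set B ->
    set_bij A B f ->
    (forall x y : G, A x -> A y -> f (x * y) = f x * f y) ->
    exists2 alpha : {multiplicative G -> G}, bijective alpha &
      forall x : G, A x -> alpha x = f x.

Definition Fraisse_limit (K : finGroupType -> Prop) (G : groupType) : Prop :=
  [/\ countable (@setT G),
      locally_finite G,
      forall gT : finGroupType, embeds gT G <-> K gT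
    & ultrahomogeneous G].

(* nil_class is #|G| when G is not nilpotent, so nilpotency is required
   separately. *)
Definition class_K (gT : finGroupType) : Prop :=
  [/\ nilpotent [set: gT]%SET /\ (nil_class [set: gT]%SET <= 2)%N,
      (exponent [set: gT]%SET %| 4)%N
    & forall x : gT, #[x] = 2 -> x \in 'Z([set: gT]%SET)].

(* Main.v *)
(** In G the elements with x^2 = 1 form a central subgroup V, and squares and
commutators lie in V.  For each n, G contains commuting e_0, ..., e_n of order
4 (set e_k = 1 for k > n) and an element a with [a, e_k] = e_{k+1}^2 for all k.
Let b be above all e_k in the enumeration, and, by homogeneity, choose d such
that an element below b commutes with d if and only if it commutes with all
e_k.  An order-preserving elementary map sending the 4-tuple (a, e_0, b, d) of
n = i to that of n = j sends elements below b_i to elements below b_j, so it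
sends e_k to an element y that commutes with the new e_k.  By induction y^2 is
the square of the new e_k as well, hence y is congruent to it modulo V.  Since
e_k^2 = 1 if and only if k > n, this forces i = j, and the sequence of these
4-tuples refutes the AZ property. *)
Require Import Defs.
From HB Require Import structures.
From mathcomp Require Import all_boot all_fingroup all_solvable all_algebra.

Set Implicit Arguments.
Unset Strict Implicit.
Unset Printing Implicit Defensive.

Import GroupScope.

(** * Finite groups given by explicit laws, and the class K elementwise *)

Definition law_carrier (T : finType) (mul : T -> T -> T) (one : T)
    (inv : T -> T) (_ : associative mul) (_ : left_id one mul)
    (_ : left_inverse one inv mul) : Type := T.

HB.instance Definition _ (T : finType) (mul : T -> T -> T) (one : T)
    (inv : T -> T) (mulA : associative mul) (mul1 : left_id one mul)
    (mulV : left_inverse one inv mul) :=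
  Finite.copy (law_carrier mulA mul1 mulV) T.

HB.instance Definition _ (T : finType) (mul : T -> T -> T) (one : T)
    (inv : T -> T) (mulA : associative mul) (mul1 : left_id one mul)
    (mulV : left_inverse one inv mul) :=
  Finite_isGroup.Build (law_carrier mulA mul1 mulV) mulA mul1 mulV.

(** [law_carrier] keeps the laws as arguments so that its group structure can be inferred from the
    type; [h] then hides this carrier. *)
Lemma finGroup_of_law (T : finType) (mul : T -> T -> T) (one : T)
    (inv : T -> T) :
  associative mul -> left_id one mul -> left_inverse one inv mul ->
  exists (gT : finGroupType) (h : T -> gT),
    bijective h /\ {morph h : x y / mul x y >-> x * y}.
Proof.
move=> mulA mul1 mulV; exists (law_carrier mulA mul1 mulV), id.
by split=> //; exists id.
Qed.

Lemma morph_mul1 (G H : groupType) (f : G -> H) :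
  {morph f : x y / x * y} -> f 1 = 1.
Proof. by move=> fM; apply: (mulgI (f 1)); rewrite -fM !mulg1. Qed.

Lemma morph_mulX (G H : groupType) (f : G -> H) (n : nat) :
  {morph f : x y / x * y} -> {morph f : x / x ^+ n}.
Proof.
move=> fM x; elim: n => [|n IHn]; first by rewrite !expg0 morph_mul1.
by rewrite !expgS fM IHn.
Qed.

Lemma morph_commute (G H : groupType) (f : G -> H) (x y : G) :
  {morph f : x y / x * y} -> commute x y -> commute (f x) (f y).
Proof. by rewrite /commute => fM xy; rewrite -!fM xy. Qed.

(** For the converse, squares square to 1, hence are central, and every commutator is a product of
    squares: this bounds the class by 2. Exponent 4 gives a 2-group by Cauchy, hence nilpotency. *)
Lemma class_KP (gT : finGroupType) :
  class_K gT <-> (forall x : gT, x ^+ 4 = 1) /\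
                 (forall x y : gT, x ^+ 2 = 1 -> commute x y).
Proof.
split=> [[_ /exponentP x4 inv_central]|[x4 inv_central]].
  split=> [x|x y x2]; first by apply: x4; rewrite inE.
  have [->|x_neq1] := eqVneq x 1; first exact/commute_sym/commute1.
  have /centerP[_] : x \in 'Z([set: gT]%SET)
    by apply/inv_central/nt_prime_order.
  by apply; rewrite inE.
have sqr_central (x y : gT) : commute (x ^+ 2) y.
  by apply: inv_central; rewrite -expgnA.
have der_central : [set: gT]^`(1) \subset 'Z([set: gT]%SET).
  rewrite derg1 gen_subG; apply/subsetP => _ /imset2P[x y _ _ ->].
  have -> : [~ x, y] = x ^- 2 * (x * y^-1) ^+ 2 * y ^+ 2.
    rewrite [X in _ * X]expg2 [X in _ * X * _]expg2 !mulgA !mulgKV.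
    by rewrite commgEl conjgE expg2 invMg !mulgA mulgKV.
  apply/centerP; split=> [|z _]; first by rewrite inE.
  by apply/commute_sym/commuteM; first apply/commuteM;
     apply/commute_sym; rewrite -?expVgn.
have cl2 : nil_class [set: gT] <= 2 by rewrite nil_class2.
split; last 1 first.
- move=> x ox; apply/centerP; split=> [|y _]; first by rewrite inE.
  by apply: inv_central; rewrite -ox expg_order.
- split=> //; apply: (@pgroup_nil _ 2); apply/pgroupP => p p_pr.
  case/Cauchy=> // x _ ox; have := x4 x; move/eqP; rewrite -order_dvdn ox.
  by rewrite -[4]/(2 ^ 2)%N Euclid_dvdX // andbT dvdn_prime2.
by apply/exponentP => x _; apply: x4.
Qed.

(** * Twisted extensions of groups in K *)

(* The semidirect product of gT by Z/4, whose generator acts as x |-> x f(x);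
   this automorphism has order at most 2 because f (f x) = 1. *)
Lemma twist_class_K (gT : finGroupType) (f : gT -> gT) :
    class_K gT -> {morph f : x y / x * y} -> (forall x, f x ^+ 2 = 1) ->
    (forall x, x ^+ 2 = 1 -> f x = 1) ->
  exists (tT : finGroupType) (i : gT -> tT) (t : tT),
    [/\ class_K tT, injective i, {morph i : x y / x * y}
      & forall x, t * i x = i (x * f x) * t].
Proof.
move=> /class_KP[x4 inv_central] fM f2 fK.
have fC x y : commute (f x) y by apply: inv_central.
have f1 : f 1 = 1 by apply: fK; rewrite expg1n.
have ff x : f (f x) = 1 by apply: fK.
have fmod x n : f x ^+ (n %% 4) = f x ^+ n.
  rewrite {2}(divn_eq n 4) expgnDr mulnC expgnA (expgnA _ 2 2) f2.
  by rewrite !expg1n mul1g.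
have fX x n : f (x ^+ n) = f x ^+ n.
  by elim: n => // n IHn; rewrite !expgS fM IHn.
have fXC x n y : commute (f x ^+ n) y.
  by apply/commute_sym/commuteX/commute_sym.
pose T : finType := (gT * 'Z_4)%type.
(* The pair [(x, a)] stands for [x * t ^+ a]; conjugation by [t ^+ a] sends [y] to [y * f y ^+ a]
   because [f (f y) = 1]. *)
pose mul (x y : T) : T := (x.1 * y.1 * f y.1 ^+ x.2, (x.2 + y.2)%R).
pose one : T := (1, 0%R).
pose inv (x : T) : T := (x.1^-1 * f x.1 ^+ x.2, (- x.2)%R).
have [|||tT [h [[k hK kK] hM]]] := @finGroup_of_law T mul one inv.
- move=> [x a] [y b] [z c]; congr pair; last by rewrite /= GRing.addrA.
  rewrite /= fmod addnC expgnDr !fM fX ff expg1n mulg1.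
  rewrite expgMn; last exact: fC.
  rewrite !mulgA; congr (_ * _).
  by rewrite -!mulgA (fXC y a (z * _)) !mulgA.
- by move=> [x a]; congr pair; rewrite /= ?GRing.add0r // mul1g mulg1.
- move=> [x a]; congr pair; rewrite /= ?GRing.addNr //.
  rewrite fmod -(fXC x a) mulgVK -expgnDr.
  rewrite subnKC; last exact/ltnW/ltn_ord.
  by rewrite (expgnA _ 2 2) f2 expg1n.
have h1 : h one = 1.
  by apply: (mulgI (h one)); rewrite -hM mulg1 /mul /= f1 !mulg1 GRing.addr0.
exists tT, (fun x => h (x, 0%R)), (h (1, 1%R)); split.
- have E x : h x ^+ 2 = h (x.1 ^+ 2 * f x.1 ^+ x.2, (x.2 + x.2)%R).
    by rewrite expg2 -hM.
  apply/class_KP; split=> [x|x y].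
    rewrite -[x]kK (expgnA _ 2 2) !E /= -h1; congr h; congr pair.
      rewrite fM !fX f2 ff !expg1n mulg1 expg1n mulg1 -[RHS](x4 (k x).1).
      rewrite expgMn; last exact/commute_sym/fXC.
      by rewrite -(expgnA (f _)) mulnC (expgnA _ 2) f2 expg1n mulg1 -expgnA.
    by case: (k x).2 => [] [|[|[|[]]]] // ?; apply: val_inj.
  rewrite -[x]kK -[y]kK E -h1 => /(can_inj hK)[]; move: (k x) (k y) => {x y}.
  case=> [x a] [y b] /= sqr_x a2.
  (* A trivial square makes [a] even, so each [f z ^+ a] is trivial; then [x ^+ 2 = 1], which makes
     [x] central and [f x] trivial. *)
  have fa1 z : f z ^+ a = 1.
    by case: a a2 {sqr_x} => [] [|[|[|[]]]].
  have {}sqr_x : x ^+ 2 = 1 by rewrite fa1 mulg1 in sqr_x.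
  rewrite /commute -!hM; congr h; congr pair; rewrite /= 1?GRing.addrC //.
  by rewrite fa1 (fK _ sqr_x) expg1n !mulg1; apply: inv_central.
- by move=> x y /(can_inj hK)[].
- by move=> x y; rewrite -hM; congr h; congr pair;
    rewrite /= ?GRing.addr0 // mulg1.
- move=> x; rewrite -!hM; congr h; congr pair; rewrite /= ?f1.
    by rewrite mul1g !mulg1 expg1.
  by rewrite GRing.addr0 GRing.add0r.
Qed.

(** In the additive group of row vectors over Z/4, written multiplicatively, [e k] is a basis
    vector, or zero for [k > n]. The twist is by the doubled shift, which sends [e k] to the square
    of [e k.+1] and kills every vector [x] with [x ^+ 2 = 1]. *)
Lemma chain_group (n : nat) :
  exists (tT : finGroupType) (e : nat -> tT) (t : tT),
    [/\ class_K tT, forall k l, commute (e k) (e l),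
        forall k, t * e k = e k * e k.+1 ^+ 2 * t,
        forall k, e k ^+ 2 = 1 <-> n < k & forall k, n < k -> e k = 1].
Proof.
pose V : finGroupType := 'rV['Z_4]_n.+1.
pose e k : V := (\row_j (j == k :> nat)%:R)%R.
pose f (v : V) : V :=
  ((\row_(j < n.+1) (if j == 0 :> nat then 0 else v ord0 (inord j.-1))) *+ 2)%R.
have VC (x y : V) : commute x y.
  by rewrite /commute !FinRing.zmodMgE GRing.addrC.
have V4 (x : V) : x ^+ 4 = 1.
  rewrite FinRing.zmodXgE; apply/rowP => j; rewrite mulmxnE.
  by rewrite -GRing.mulr_natr char_Zp // GRing.mulr0 mxE.
have Kv : class_K V by apply/class_KP; split.
have fM : {morph f : x y / x * y}.
  move=> x y; rewrite !FinRing.zmodMgE -GRing.mulrnDl; congr (_ *+ 2)%R.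
  by apply/rowP => j; rewrite !mxE; case: ifP => // _; rewrite GRing.addr0.
have f2 x : f x ^+ 2 = 1 by rewrite -(expgnA _ 2 2) V4.
have fK x : x ^+ 2 = 1 -> f x = 1.
  rewrite FinRing.zmodXgE => /rowP x2; apply/rowP => j.
  rewrite mulmxnE !mxE.
  case: ifP => _; first by rewrite GRing.mul0rn.
  by have := x2 (inord j.-1); rewrite mulmxnE !mxE.
have [tT [i [t [Kt i_inj iM tP]]]] := twist_class_K Kv fM f2 fK.
have i1 := morph_mul1 iM.
have i2 x : i (x ^+ 2) = i x ^+ 2 by rewrite morph_mulX.
have fe k : f (e k) = e k.+1 ^+ 2.
  rewrite FinRing.zmodXgE; congr (_ *+ 2)%R; apply/rowP => j; rewrite !mxE.
  case: (posnP j) => [->|j_gt0] //.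
  rewrite inordK ?(leq_ltn_trans (leq_pred _)) //.
  by rewrite -{2}(prednK j_gt0).
have e1 k : n < k -> e k = 1.
  move=> nk; apply/rowP => j; rewrite !mxE.
  by rewrite ltn_eqF // (leq_trans (ltn_ord j)).
exists tT, (fun k => i (e k)), t; split=> //.
- by move=> k l; rewrite /commute -!iM VC.
- by move=> k; rewrite -i2 -fe -iM.
- move=> k; rewrite -i2; split; last first.
    by move/e1->; rewrite expg1n.
  move=> /eqP; rewrite -{1}i1 => /eqP/i_inj.
  rewrite FinRing.zmodXgE => /rowP H; rewrite ltnNge; apply/negP => kn.
  (* Coordinate [k] of the square of [e k] is 2, nonzero modulo 4. *)
  have := H (inord k); rewrite mulmxnE !mxE inordK // eqxx.
  by move/(congr1 val).
- by move=> k /e1->.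
Qed.

(* Twist gT x gT / 'C(D) by the canonical projection into the second factor. *)
Lemma centraliser_group (gT : finGroupType) (D : {set gT}) :
  class_K gT ->
  exists (tT : finGroupType) (i : gT -> tT) (t : tT),
    [/\ class_K tT, injective i, {morph i : x y / x * y}
      & forall x, commute t (i x) <-> x \in 'C(D)].
Proof.
move=> KgT; have [x4 inv_central] := (class_KP gT).1 KgT.
(* The centraliser contains the centre, hence the derived subgroup. *)
have nC : [set: gT] \subset 'N('C(D)).
  case: KgT => [[_]]; rewrite nil_class2 => der_central _ _.
  apply/normal_norm/sub_der1_normal; last exact: subsetT.
  by apply: subset_trans der_central _; rewrite subIset // centS ?orbT ?subsetT.
pose c := coset 'C(D).
have cM : {morph c : x y / x * y}.
  by move=> x y; apply: morphM; apply: (subsetP nC); rewrite inE.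
have cK x : (c x = 1) <-> (x \in 'C(D)).
  split=> [|xC]; last exact: coset_id.
  by apply: coset_idr; apply: (subsetP nC); rewrite inE.
have sqrC x : x ^+ 2 \in 'C(D).
  by apply/centP => y _; apply: inv_central; rewrite -expgnA.
have q2 (u : coset_of 'C(D)) : u ^+ 2 = 1.
  by case: (cosetP u) => x _ ->; rewrite expg2 -cM -expg2; apply/cK.
have qC (u v : coset_of 'C(D)) : commute u v.
  have qV (w : coset_of 'C(D)) : w = w^-1.
    by apply: (mulgI w); rewrite mulgV -expg2.
  by rewrite /commute (qV (u * v)) invMg -!qV.
pose P : finGroupType := (gT * coset_of 'C(D))%type.
(* The new generator commutes with [(x, 1)] exactly when [c x = 1]. Involutions of [gT] are central,
   hence killed by [c], as the twist demands. *)
pose f (x : P) : P := (1, c x.1).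
have KP : class_K P.
  apply/class_KP; split=> [[x u]|[x u] [y v]].
    rewrite !expgS expg0; congr pair; first by have := x4 x; rewrite !expgS.
    by have := congr1 (fun w => w ^+ 2) (q2 u); rewrite -expgnA expg1n !expgS.
  rewrite expg2 => -[x2 _]; congr pair; last exact: qC.
  exact: inv_central.
have [|||tT [i [t [Kt i_inj iM tP]]]] := @twist_class_K P f KP.
- by move=> x y; congr pair; rewrite ?mulg1 //= cM.
- by move=> x; rewrite expg2; congr pair; rewrite /= ?mulg1 // -expg2.
- move=> [x u]; rewrite expg2 => -[x2 _]; congr pair; apply/cK/centP => y _.
  exact: inv_central.
exists tT, (fun x => i (x, 1)), t; split=> //.
- by move=> x y /i_inj[].
- by move=> x y; rewrite -iM; congr i; congr pair; rewrite mulg1.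
- move=> x; rewrite /commute tP -cK; split=> [/mulIg/i_inj|cx].
    by move/(canRL (mulKg _)); rewrite mulVg => -[].
  by congr (i _ * t); congr pair; rewrite /= ?cx mulg1.
Qed.

From mathcomp Require Import boolp classical_sets cardinality.
Local Open Scope classical_set_scope.

(** * Finite subgroups and the extension property of the Fraïssé limit *)

Lemma multiplicative_of (G H : groupType) (f : G -> H) :
  {morph f : x y / x * y} -> exists g : {multiplicative G -> H}, g =1 f.
Proof.
move=> fM; pose m := isMultiplicative.Build G H f fM.
by exists (HB.pack_for {multiplicative G -> H} f m).
Qed.

Lemma subgroup_finGroup (G : groupType) (H : set G) :
  subgroup H -> finite_set H ->
  exists (gT : finGroupType) (h : {multiplicative gT -> G}),
    injective h /\ range h = H.
Proof.
move=> [H1 HF] /finite_seqP[s HE].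
have HV x : H x -> H x^-1 by move=> Hx; rewrite -[x^-1]mul1g; apply: HF.
have HM x y : H x -> H y -> H (x * y).
  by move=> Hx Hy; rewrite -[y]invgK; apply/HF/HV.
have HP x : reflect (H x) (x \in s).
  by rewrite HE; apply: idP.
pose T : finType := seq_sub s.
have HT (x : T) : H (val x) by apply/HP/valP.
pose mul (x y : T) : T := SeqSub (introT (HP _) (HM _ _ (HT x) (HT y))).
pose one : T := SeqSub (introT (HP _) H1).
pose inv (x : T) : T := SeqSub (introT (HP _) (HV _ (HT x))).
have [|||gT [h [[k hK kK] hM]]] := @finGroup_of_law T mul one inv.
- by move=> x y z; apply/val_inj; rewrite /= mulgA.
- by move=> x; apply/val_inj; rewrite /= mul1g.
- by move=> x; apply/val_inj; rewrite /= mulVg.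
have [|g gE] := @multiplicative_of gT G (fun x => val (k x)).
  by move=> x y; rewrite -{1}[x]kK -{1}[y]kK -hM hK.
exists gT, g; split.
  by move=> x y; rewrite !gE => /val_inj /(can_inj kK).
rewrite predeqE => x; split=> [[y _ <-]|/HP Hx]; first by rewrite gE.
by exists (h (SeqSub Hx)) => //; rewrite gE hK.
Qed.

Lemma smallest_subgroup (G : groupType) (S : set G) :
  subgroup (smallest (@subgroup G) S).
Proof.
by split=> [H [[]]|x y Sx Sy H SH] //; apply: SH.1.2; [apply: Sx|apply: Sy].
Qed.

(** By local finiteness [s] generates a finite subgroup, so questions about finitely many elements
    can be settled in K. *)
Lemma finite_subset_in_K (G : groupType) (hG : Fraisse_limit class_K G)
    (s : seq G) :
  exists (gT : finGroupType) (h : {multiplicative gT -> G}),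
    [/\ class_K gT, injective h & {in s, forall x, exists y, h y = x}].
Proof.
have [_ lfG age _] := hG.
have finS := lfG [set` s] (finite_seq s).
have [gT [h [h_inj hE]]] := subgroup_finGroup (smallest_subgroup _) finS.
exists gT, h; split=> //; first by apply/age; exists h.
move=> x xs; suff /= : smallest (@subgroup G) [set` s] x.
  by rewrite -hE => -[y]; exists y.
by move=> H [_]; apply.
Qed.

Lemma involution_central_limit (G : groupType) (hG : Fraisse_limit class_K G)
    (x y : G) :
  x ^+ 2 = 1 -> commute x y.
Proof.
have [gT [h [/class_KP[_ inv_central] h_inj hs]]] :=
  finite_subset_in_K hG [:: x; y].
have [x' <-] := hs x (mem_head _ _).
have [|y' <-] := hs y; first by rewrite !inE eqxx orbT.
have hM := @gmulfM _ _ h.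
rewrite -(morph_mulX _ hM) -(morph_mul1 hM) => /h_inj x2.
exact/(morph_commute hM)/inv_central.
Qed.

(** Embed [tT] into [G] by any [g]. Then [g \o i] and [h] give two copies of [gT] in [G];
    homogeneity supplies an automorphism carrying the first to the second, and composing it with [g]
    gives the extension. *)
Lemma limit_extend (G : groupType) (hG : Fraisse_limit class_K G)
    (gT tT : finGroupType) (h : {multiplicative gT -> G}) (i : gT -> tT) :
    injective h -> injective i -> {morph i : x y / x * y} -> class_K tT ->
  exists g : tT -> G,
    [/\ injective g, {morph g : x y / x * y} & forall x, g (i x) = h x].
Proof.
move=> h_inj i_inj iM KtT.
have [_ _ age homog] := hG.
have [g g_inj] := (age tT).2 KtT.
pose k x := g (i x).
have kM : {morph k : x y / x * y} by move=> x y; rewrite /k iM gmulfM.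
have k_inj : injective k by move=> x y /g_inj/i_inj.
have sub_range (l : gT -> G) : {morph l : x y / x * y} -> subgroup (range l).
  move=> lM; have l1 := morph_mul1 lM.
  split=> [|_ _ [x _ <-] [y _ <-]]; first by exists 1.
  exists (x * y^-1) => //; rewrite lM; congr (_ * _).
  by apply: (mulgI (l y)); rewrite -lM !mulgV.
have fin_range (l : gT -> G) : finite_set (range l).
  exact/finite_image/finite_finset.
(* This is [h] after the inverse of [k], with default value 1 off the range of [k]. *)
pose f z := if [pick x | k x == z] is Some x then h x else 1.
have fE x : f (k x) = h x.
  by rewrite /f; case: pickP => [y /eqP/k_inj-> //|/(_ x)]; rewrite eqxx.
have [||alpha alpha_bij alphaE] := homog _ _ f (sub_range k kM) (fin_range k)
   (sub_range h (@gmulfM _ _ h)) (fin_range h).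
- split=> [_ [x _ <-]|_ _ /set_mem[x _ <-] /set_mem[y _ <-]|_ [x _ <-]].
  + by exists x.
  + by rewrite !fE => /h_inj->.
  + by exists (k x) => //; exists x.
- by move=> _ _ [x _ <-] [y _ <-]; rewrite -kM !fE gmulfM.
exists (fun x => alpha (g x)); split.
- by move=> x y /(bij_inj alpha_bij)/g_inj.
- by move=> x y; rewrite !gmulfM.
- by move=> x; rewrite -fE alphaE //; exists x.
Qed.

(** Since [D] lies in [s], it has a full preimage [D'] in a finite group of K; the generator from
    [centraliser_group] is then realised in [G] by [limit_extend]. *)
Lemma limit_centraliser (G : groupType) (hG : Fraisse_limit class_K G)
    (s : seq G) (D : set G) :
    (forall y, D y -> y \in s) ->
  exists d : G, forall x, x \in s ->
    commute d x <-> forall y, D y -> commute x y.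
Proof.
move=> Ds; have [gT [h [K_gT h_inj hs]]] := finite_subset_in_K hG s.
pose D' : {set gT} := [set x | `[< D (h x) >]]%SET.
have [tT [i [t [K_tT i_inj iM tP]]]] := centraliser_group D' K_gT.
have [g [g_inj gM gh]] := limit_extend hG h_inj i_inj iM K_tT.
exists (g t) => x /hs[{}x <-]; rewrite -gh /commute -!gM.
have -> : (g (t * i x) = g (i x * t)) <-> commute t (i x).
  by split=> [/g_inj|->].
rewrite tP; split=> [/centP xC y Dy|xC].
  have [y' yE] := hs y (Ds y Dy).
  rewrite gh -yE; apply/(morph_commute (@gmulfM _ _ h))/xC.
  by rewrite inE; apply/asboolP; rewrite yE.
apply/centP => y; rewrite inE => /asboolP Dy.
by apply: h_inj; rewrite !gmulfM -[h x]gh; apply: xC.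
Qed.

Lemma limit_chain (G : groupType) (hG : Fraisse_limit class_K G) (n : nat) :
  exists (e : nat -> G) (a : G),
    [/\ forall k l, commute (e k) (e l),
        forall k, a * e k = e k * e k.+1 ^+ 2 * a,
        forall k, e k ^+ 2 = 1 <-> n < k & forall k, n < k -> e k = 1].
Proof.
have [tT [e [t [KtT eC tE e2 e1]]]] := chain_group n.
have [_ _ age _] := hG; have [g g_inj] := (age tT).2 KtT.
have gM := @gmulfM _ _ g.
exists (g \o e), (g t); split=> [k l|k|k|k nk] /=.
- exact: morph_commute.
- by rewrite -(morph_mulX _ gM) -!gM tE.
- by rewrite -e2 -(morph_mulX _ gM) -(morph_mul1 gM); split=> [/g_inj|->].
- by rewrite e1 // morph_mul1.
Qed.

(** * Guarded chains in an enumerated limit *)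

(* The tuple c is (a, e_0, b, d). *)
Definition guarded_chain (G : groupType) (lt : G -> G -> Prop) (n : nat)
    (c : 4.-tuple G) : Prop :=
  exists e : nat -> G,
    [/\ e 0 = tnth c 1%R,
        forall k, tnth c 0%R * e k = e k * e k.+1 ^+ 2 * tnth c 0%R,
        forall k, e k ^+ 2 = 1 <-> n < k,
        forall k, lt (e k) (tnth c 2%R) /\ commute (tnth c 3%R) (e k)
      & forall y, lt y (tnth c 2%R) -> commute (tnth c 3%R) y ->
          forall k, commute y (e k)].

Lemma guarded_chain_exists (G : groupType) (hG : Fraisse_limit class_K G)
    (lt : G -> G -> Prop) (n : nat) :
  order_type_omega lt -> exists c, guarded_chain lt n c.
Proof.
move=> [u [v uK vK] ltE].
have [e [a [eC aE e2 e1]]] := limit_chain hG n.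
(* The index [n.+1] is included because [e n.+1] is 1, the value of all later [e k]. *)
pose N := (\max_(k < n.+2) v (e k)).+1.
have vN k : v (e k) < N.
  rewrite ltnS; case: (ltnP k n.+2) => [kn|/ltnW kn].
    by rewrite (leq_bigmax (Ordinal kn)).
  by rewrite e1 // -(e1 n.+1) // (leq_bigmax (ord_max : 'I_n.+2)).
have ltN y : lt y (u N) <-> v y < N by rewrite -{1}[y]vK ltE.
have sP y : v y < N -> y \in map u (iota 0 N).
  by move=> yN; apply/mapP; exists (v y); rewrite ?mem_iota ?vK.
(* Order type omega leaves finitely many elements below [u N], and these form the list [s]. *)
have [|d dP] := @limit_centraliser G hG (map u (iota 0 N)) (range e).
  by move=> _ [k _ <-]; apply/sP/vN.
exists [tuple a; e 0; u N; d], e; split=> // [k|y /ltN yN dy k].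
  split; first exact/ltN/vN.
  by apply/dP => [|_ [l _ <-]]; [apply/sP/vN|apply: eC].
by move/dP: dy; apply; [apply/sP|exists k].
Qed.

Lemma guarded_chain_inj (G : groupType) (hG : Fraisse_limit class_K G)
    (lt : G -> G -> Prop) (alpha : G -> G) (m n : nat) (b c : 4.-tuple G) :
    {morph alpha : x y / x * y} -> injective alpha ->
    (forall x y, lt x y -> lt (alpha x) (alpha y)) ->
    guarded_chain lt m b -> guarded_chain lt n c -> map_tuple alpha b = c ->
  m = n.
Proof.
move=> alphaM alpha_inj alpha_lt [e [e0 be e2 eb bP]] [f [f0 cf f2 fc cP]] bc.
have cE i : tnth c i = alpha (tnth b i) by rewrite -bc tnth_map.
have alpha1 := morph_mul1 alphaM.
have alphaE k : exists2 z, alpha (e k) = f k * z & z ^+ 2 = 1.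
  elim: k => [|k [z ez z2]].
    by exists 1; rewrite ?expg1n // mulg1 e0 f0 cE.
  exists ((f k.+1)^-1 * alpha (e k.+1)); first by rewrite mulVKg.
  have [ltk dk] := eb k.+1.
  (* Lying below the bound and commuting with the guard are both preserved by [alpha], so the last
     clause of the chain [c] applies. *)
  have cef : commute (alpha (e k.+1)) (f k.+1).
    by apply: cP; rewrite cE; [apply: alpha_lt|apply: morph_commute].
  rewrite expgMn; last exact/commute_sym/commuteV.
  rewrite expVgn; apply: (mulgI (f k.+1 ^+ 2)); rewrite mulVKg mulg1.
  (* The image of the relation for [e k] is compared with the relation for [f k]; the central [z]
     cancels and the two squares agree. *)
  have := congr1 alpha (be k); rewrite !expg2 !alphaM -cE ez -!expg2.
  rewrite mulgA cf -!mulgA => /mulgI.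
  by rewrite (involution_central_limit hG _ z2) !mulgA => /mulIg/mulIg.
have sq k : e k ^+ 2 = 1 <-> f k ^+ 2 = 1.
  have [z ez z2] := alphaE k.
  have : alpha (e k ^+ 2) = f k ^+ 2.
    rewrite expg2 alphaM -expg2 ez expgMn ?z2 ?mulg1 //.
    exact/commute_sym/(involution_central_limit hG).
  by split=> E; [rewrite -H E alpha1|apply: alpha_inj; rewrite H E alpha1].
have mn k : m < k <-> n < k by rewrite -e2 -f2.
by case: (ltngtP m n) => // /mn; rewrite ltnn.
Qed.

(** * Elementary maps and the conclusion *)

Lemma elementary_group_morph (G : groupType)
    (alpha : group_structure G -> group_structure G) :
  elementary alpha -> {morph (alpha : G -> G) : x y / x * y}.
Proof.
move=> alpha_el x y.
pose var n : term group_language := Var group_language n.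
pose xy : term group_language :=
  @App group_language MulSymbol (fun i : 'I_2 => var (i : nat)).
(* Under [v], variable 2 is the product of variables 0 and 1, and [alpha] preserves this
   equation. *)
pose v n : group_structure G :=
  if n is 0 then x else if n is 1 then y else x * y.
by have [+ _] := alpha_el (Eq (var 2) xy) v; apply.
Qed.

Lemma elementary_injective (L : language) (M N : structure L) (alpha : M -> N) :
  elementary alpha -> injective alpha.
Proof.
move=> alpha_el x y xy.
pose v n := if n is 0 then x else y.
by have [_] := alpha_el (Eq (Var L 0) (Var L 1)) v; apply.
Qed.

Theorem theorem1p1 (G : groupType) (hG : Fraisse_limit class_K G) :
  ~ exists lt : group_structure G -> group_structure G -> Prop,
      AZ_enumeration lt.
Proof.
move=> [lt [lt_omega az]].
have [c cP] := choice (fun n => guarded_chain_exists hG n lt_omega).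
have [i [j [neq_ij [alpha [alpha_el alpha_lt alphac]]]]] := az 4 c.
case: neq_ij; apply: (guarded_chain_inj hG _ _ alpha_lt (cP i) (cP j) alphac).
  exact: elementary_group_morph.
exact: (elementary_injective (M := group_structure G) alpha_el).
Qed.
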